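(* Let $G$ be a finite graph with at least one edge. Then the Cartesian product graph $G\times\mathbb{Z}$ does not admit a harmonic labeling.
   Context: $\mathbb{Z}$ denotes the graph with vertex set $\mathbb{Z}$ and edges $\{i,i+1\}$. The Cartesian product $G\times\mathbb{Z}$ has vertex set $V(G)\times\mathbb{Z}$, with $(u,i)\sim(v,j)$ iff either $u=v$ and $|i-j|=1$, or $i=j$ and $u\sim v$ in $G$ (so each vertex has degree $\deg_G(u)+2$). For a graph in which every vertex has finite degree, a function $\phi:V\to\mathbb{Z}$ is harmonic if $\phi(x)=\frac{1}{\deg(x)}\sum_{y\sim x}\phi(y)$ for all vertices $x$. A harmonic labeling is a harmonic function $\phi:V\to\mathbb{Z}$ that is a bijection onto $\mathbb{Z}$. *)

(* Defs.v *)
From mathcomp Require Import all_boot all_order all_algebra finmap.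
From mathcomp Require Import boolp classical_sets functions cardinality.

Set Implicit Arguments.
Unset Strict Implicit.
Unset Printing Implicit Defensive.

Import Order.TTheory GRing.Theory Num.Theory.
Local Open Scope classical_set_scope.
Local Open Scope ring_scope.

(* A simple graph on a vertex type V is given by its adjacency
   relation [e : rel V], assumed symmetric and irreflexive where relevant. *)

Definition neighbors (V : choiceType) (e : rel V) (x : V) : set V :=
  [set y | e x y].

Definition locally_finite (V : choiceType) (e : rel V) : Prop :=
  forall x, finite_set (neighbors e x).

(* [fset_set] of an infinite set is empty, so [degree] and [harmonic] are
   meaningful only for locally finite graphs. *)
Definition degree (V : choiceType) (e : rel V) (x : V) : nat :=
  #|` fset_set (neighbors e x)|.

Definition harmonic (V : choiceType) (e : rel V) (phi : V -> int) : Prop :=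
  forall x, (phi x)%:~R =
    ((degree e x)%:R^-1 * \sum_(y <- fset_set (neighbors e x)) (phi y)%:~R
      :> rat).

Definition harmonic_labeling (V : choiceType) (e : rel V) (phi : V -> int) :
    Prop :=
  harmonic e phi /\ bijective phi.

Definition int_adj : rel int := fun i j => `|i - j| == 1.

Definition cartesian (V W : choiceType) (e : rel V) (f : rel W) : rel (V * W) :=
  fun x y => (x.1 == y.1) && f x.2 y.2 || (x.2 == y.2) && e x.1 y.1.

Lemma neighbors_cartesian_int (T : finType) (e : rel T) (u : T) (i : int) :
  neighbors (cartesian e int_adj) (u, i) =
  [set` [:: (u, i + 1), (u, i - 1) & [seq (v, i) | v <- enum (e u)]]].
Proof.
apply/seteqP; split=> -[v j] /=; rewrite /neighbors /cartesian /int_adj /=.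
  case/orP=> /andP[/eqP<-].
    rewrite eqr_norml ler01 andbT => /orP[]/eqP h;
      have -> : j = i - (i - j) by rewrite opprB addrC subrK.
      by rewrite h !inE eqxx orbT.
    by rewrite h opprK !inE eqxx.
  move=> euv; rewrite !inE; apply/orP; right; apply/orP; right.
  by apply/mapP; exists v; rewrite // mem_enum.
rewrite !inE => /or3P[/eqP[-> ->]|/eqP[-> ->]|/mapP[w]].
- by rewrite eqxx opprD addNKr normrN1.
- by rewrite eqxx opprB addrC subrK normr1.
- by rewrite mem_enum => euw [-> ->]; rewrite eqxx orbC [e _ _]euw.
Qed.

Lemma locally_finite_cartesian_int (T : finType) (e : rel T) :
  locally_finite (cartesian e int_adj).
Proof. by case=> u i; rewrite neighbors_cartesian_int; exact: finite_seq. Qed.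

Lemma degree_cartesian_int (T : finType) (e : rel T) (u : T) (i : int) :
  irreflexive e -> degree (cartesian e int_adj) (u, i) = (#|e u| + 2)%N.
Proof.
move=> e_irr; rewrite /degree.
set s := [:: (u, i + 1), (u, i - 1) & [seq (v, i) | v <- enum (e u)]].
have us : uniq s.
  have notin j : (u, j) \notin [seq (v, i) | v <- enum (e u)].
    apply/mapP => -[v]; rewrite mem_enum => euv [uv _].
    by move: euv; rewrite -uv unfold_in e_irr.
  rewrite /s /= !inE negb_or !notin andbT /=; apply/andP; split.
    by rewrite xpair_eqE eqxx (inj_eq (addrI i)).
  by rewrite map_inj_uniq ?enum_uniq // => v w [].
have -> : (#|e u| + 2)%N = size s by rewrite /= size_map -cardE addn2.
apply: perm_size; apply: uniq_perm => // x.
rewrite in_fset_set; last exact: locally_finite_cartesian_int.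
by rewrite neighbors_cartesian_int; apply/idP/idP; rewrite inE.
Qed.

(* Main.v *)
(* Let y(u, i) be the second difference of i |-> phi(u, i).  Harmonicity says
   that y(., i) = L phi(., i), with L the Laplacian of G, and L is symmetric and
   positive semidefinite; hence, with E the shift in i, each phi(u, .) is
   annihilated by the product over the eigenvalues d of L of
   E^2 - (2 + d) E + 1 = (E - mu) (E - 1/mu), mu > 0.  By a discrete Rolle
   argument y(u, .), which is annihilated too, is identically zero or eventually
   of constant strict sign in both directions.  Being integer valued, it is then
   eventually >= 1 in absolute value, so each line phi(u, .) is either affine or
   superlinear at both ends.  Not all lines are affine, by the maximum principle
   and injectivity.  Let r be a value on a non-affine line and M the product of
   the slopes of the affine lines: no affine line meets r + M Z, so the
   superlinear lines would have to cover this set of positive density. *)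

Require Import Defs.
From mathcomp Require Import all_boot all_order all_algebra.
From mathcomp Require Import all_field finmap boolp classical_sets cardinality.
From mathcomp Require Import zify ring.

Set Implicit Arguments.
Unset Strict Implicit.
Unset Printing Implicit Defensive.

Import Order.TTheory GRing.Theory Num.Theory.
Local Open Scope ring_scope.

(** * Eventual signs of sequences under linear recurrences *)

Definition eventually_signed (R : numDomainType) (z : nat -> R) : Prop :=
  [\/ exists N, forall i, (N <= i)%N -> 0 < z i,
      exists N, forall i, (N <= i)%N -> z i < 0
    | forall i, z i = 0].

Lemma eventually_signedN (R : numDomainType) (z : nat -> R) :
  eventually_signed (fun i => - z i) -> eventually_signed z.
Proof.
case=> [[N zN]|[N zN]|z0].
- by apply: Or32; exists N => i /zN; rewrite oppr_gt0.
- by apply: Or31; exists N => i /zN; rewrite oppr_lt0.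
- by apply: Or33 => i; apply/eqP; rewrite -oppr_eq0 z0.
Qed.

(** Past [N], one nonnegative term forces all later terms to be positive; if there is none, [z] is
    negative from [N] on. *)
Lemma eventually_signed_factor_gt0 (R : numDomainType) (mu : R) (z : nat -> R) :
  0 < mu -> (forall i, z i \is Num.real) ->
  (exists N, forall i, (N <= i)%N -> 0 < z i.+1 - mu * z i) ->
  eventually_signed z.
Proof.
move=> mu0 zr [N zN].
have [[k [Nk zk]]|noz] := pselect (exists k, (N <= k)%N /\ 0 <= z k).
  apply: Or31; exists k.+1 => -[//|i]; rewrite ltnS => ki.
  suff: 0 <= z i.
    move=> zi; have := zN i (leq_trans Nk ki); rewrite subr_gt0.
    by apply: le_lt_trans; rewrite mulr_ge0 // ltW.
  elim: i ki => [|i IHi]; first by rewrite leqn0 => /eqP <-.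
  rewrite leq_eqVlt => /predU1P[<- //|ki].
  have := zN i (leq_trans Nk ki); rewrite subr_gt0 => /ltW; apply: le_trans.
  by rewrite mulr_ge0 ?IHi // ltW.
apply: Or32; exists N => i Ni; rewrite real_ltNge ?real0 //.
by apply/negP => zi; apply: noz; exists i.
Qed.

(* Discrete Rolle: taking [z] to [z (i + 1) - mu z i] loses at most one sign
   change. *)
Lemma eventually_signed_factor (R : numDomainType) (mu : R) (z : nat -> R) :
  0 < mu -> (forall i, z i \is Num.real) ->
  eventually_signed (fun i => z i.+1 - mu * z i) -> eventually_signed z.
Proof.
move=> mu0 zr [zpos|[N zN]|z0].
- exact: eventually_signed_factor_gt0 zpos.
- apply: eventually_signedN; apply: (eventually_signed_factor_gt0 mu0).
    by move=> i; rewrite realN.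
  by exists N => i /zN; rewrite mulrN -opprD oppr_gt0.
have zE i : z i = mu ^+ i * z 0.
  elim: i => [|i IHi]; first by rewrite mul1r.
  by rewrite exprS -mulrA -IHi; apply/eqP; rewrite -subr_eq0 z0.
have [z00|z00|z00] := real_ltgtP (real0 R) (zr 0%N).
- by apply: Or31; exists 0%N => i _; rewrite zE mulr_gt0 ?exprn_gt0.
- by apply: Or32; exists 0%N => i _; rewrite zE pmulr_rlt0 ?exprn_gt0.
- by apply: Or33 => i; rewrite zE -z00 mulr0.
Qed.

(* Factors the characteristic polynomial X^2 - (2 + d) X + 1. *)
Lemma pos_sum_inv (d : algC) : 0 <= d ->
  exists2 mu : algC, 0 < mu & mu + mu^-1 = 2 + d.
Proof.
move=> d0; pose s := sqrtC (d * (d + 4)).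
have s2 : s ^+ 2 = d * (d + 4) by rewrite sqrtCK.
have s0 : 0 <= s by rewrite sqrtC_ge0 mulr_ge0 // addr_ge0.
have mu0 : 0 < (2 + d + s) / 2.
  by rewrite divr_gt0 ?ltr0n // -addrA ltr_wpDr ?ltr0n // addr_ge0.
exists ((2 + d + s) / 2) => //.
have -> : ((2 + d + s) / 2)^-1 = (2 + d - s) / 2.
  apply: (mulfI (lt0r_neq0 mu0)); rewrite mulfV ?lt0r_neq0 //.
  transitivity (((2 + d) ^+ 2 - s ^+ 2) / 4); last by field.
  by rewrite s2; field.
by field.
Qed.

(** Induction on [ds]: the sequence [g i.+1 *m (L - d%:M)] obeys the same recurrence and needs one
    factor less. By the recurrence it also arises from [g] by the two first-order factors with
    parameters [mu] and [mu^-1], so two discrete Rolle steps lead back to [g]. *)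
Lemma eventually_signed_matrix_recurrence (n : nat) (L : 'M[algC]_n.+1)
    (ds : seq algC) (g : nat -> 'rV[algC]_n.+1) :
  {in ds, forall d, 0 <= d} ->
  (forall i j, L i j \is Num.real) ->
  (forall i j, g i 0 j \is Num.real) ->
  (forall i, g i.+2 + g i = 2 *: g i.+1 + g i.+1 *m L) ->
  (forall i, g i *m \prod_(d <- ds) (L - d%:M) = 0) ->
  forall j, eventually_signed (fun i => g i 0 j).
Proof.
move=> + Lr; elim: ds g => [|d ds IHds] g ds0 gr grec gann j.
  by apply: Or33 => i; have := gann i; rewrite big_nil mulmx1 => ->; rewrite mxE.
have d0 : 0 <= d by apply: ds0; rewrite mem_head.
have [mu mu0 muE] := pos_sum_inv d0.
have hE i : (g i *m (L - d%:M)) 0 j = (g i *m L) 0 j - d * g i 0 j.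
  by rewrite mulmxBr mul_mx_scalar !mxE.
have hs : eventually_signed (fun i => (g i.+1 *m (L - d%:M)) 0 j).
  apply: (IHds (fun i => g i.+1 *m (L - d%:M))) => [x xds|i k|i|i].
  - by apply: ds0; rewrite inE xds orbT.
  - rewrite mxE rpred_sum // => l _; rewrite rpredM ?gr // !mxE rpredB //.
    by rewrite rpredMn // ger0_real.
  - rewrite -mulmxDl grec mulmxDl scalemxAl -!mulmxA; congr (_ + _ *m _).
    by rewrite mulmxBl mulmxBr mul_scalar_mx mul_mx_scalar.
  - by have := gann i.+1; rewrite big_cons mulmxA.
apply: (eventually_signed_factor mu0) => //.
have muV0 : 0 < mu^-1 by rewrite invr_gt0.
apply: (eventually_signed_factor muV0) => [i|].
  by rewrite rpredB ?rpredM // gtr0_real.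
have eqf : (fun i => g i.+2 0 j - mu * g i.+1 0 j
                    - mu^-1 * (g i.+1 0 j - mu * g i 0 j))
   = (fun i => (g i.+1 *m (L - d%:M)) 0 j).
  apply: funext => i; rewrite hE.
  have := congr1 (fun v : 'rV_n.+1 => v 0 j) (grec i); rewrite !mxE => reci.
  rewrite mulrBr mulrA mulVf ?lt0r_neq0 // mul1r.
  transitivity (g i.+2 0 j + g i 0 j - (mu + mu^-1) * g i.+1 0 j); first by ring.
  by rewrite muE reci; ring.
by rewrite eqf.
Qed.

(** * The graph Laplacian and its spectrum *)

(** The matrix acts on row vectors from the right, whence [e j i]; over [algC] its characteristic
    polynomial splits. *)
Definition laplacian_mx (n : nat) (e : rel 'I_n) : 'M[algC]_n :=
  \matrix_(i, j) ((#|e j|%:R *+ (i == j)) - (e j i)%:R).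

Lemma mul_laplacian_mx (n : nat) (e : rel 'I_n) (g : 'rV[algC]_n) (j : 'I_n) :
  (g *m laplacian_mx e) 0 j = \sum_(i | e j i) (g 0 j - g 0 i).
Proof.
rewrite mxE; under eq_bigr do rewrite mxE mulrBr.
rewrite sumrB (bigD1 j) //= eqxx mulr1n big1 ?addr0; last first.
  by move=> i /negPf ->; rewrite mulr0.
rewrite sumrB sumr_const mulr_natr; congr (_ - _).
rewrite [RHS]big_mkcond; apply: eq_bigr => i _.
by case: (e j i); rewrite ?mulr1 ?mulr0.
Qed.

(** Dirichlet form: pairing an eigenvector with its conjugate gives [E], which is [a] times the
    squared norm, while [E + E] is a sum of squared moduli over oriented edges. *)
Lemma laplacian_eigenvalue_ge0 (n : nat) (e : rel 'I_n) (a : algC) :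
  symmetric e -> eigenvalue (laplacian_mx e) a -> 0 <= a.
Proof.
move=> e_sym /eigenvalueP[v vL v0].
pose E := \sum_j \sum_(i | e j i) (v 0 j)^* * (v 0 j - v 0 i).
have EE : E = a * \sum_j `|v 0 j| ^+ 2.
  rewrite mulr_sumr; apply: eq_bigr => j _.
  by rewrite -mulr_sumr -mul_laplacian_mx vL mxE normCK; ring.
(* Each edge is read from its other end, by symmetry of [e]. *)
have E' : E = \sum_j \sum_(i | e j i) (v 0 i)^* * (v 0 i - v 0 j).
  rewrite /E (exchange_big_dep xpredT) //=; apply: eq_bigr => i _.
  by apply: eq_bigl => j; rewrite e_sym.
have E2 : E + E = \sum_j \sum_(i | e j i) `|v 0 j - v 0 i| ^+ 2.
  rewrite {2}E' -big_split; apply: eq_bigr => j _; rewrite -big_split.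
  by apply: eq_bigr => i _ /=; rewrite normCK rmorphB; ring.
have E0 : 0 <= E.
  have : 0 <= E + E by rewrite E2; do 2 (apply: sumr_ge0 => ? _); rewrite exprn_ge0.
  by rewrite -mulr2n pmulrn_lge0.
have S0 : 0 < \sum_j `|v 0 j| ^+ 2.
  have [j vj] : exists j, v 0 j != 0.
    apply/existsP; apply: contraNT v0 => /existsPn v0.
    by apply/eqP/rowP => j; rewrite mxE; apply/eqP/negPn.
  rewrite (bigD1 j) //= ltr_wpDr ?exprn_gt0 ?normr_gt0 //.
  by apply: sumr_ge0 => i _; rewrite exprn_ge0.
by move: E0; rewrite EE pmulr_lge0.
Qed.

(** Cayley-Hamilton, with the characteristic polynomial split into linear factors; its roots are
    eigenvalues. *)
Lemma laplacian_mx_annihilator (n : nat) (e : rel 'I_n.+1) : symmetric e ->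
  exists2 ds : seq algC, {in ds, forall d, 0 <= d} &
    \prod_(d <- ds) (laplacian_mx e - d%:M) = 0.
Proof.
move=> e_sym; have [ds pE] := closed_field_poly_normal (char_poly (laplacian_mx e)).
rewrite (monicP (char_poly_monic _)) scale1r in pE.
exists ds => [d dds|].
  apply: (laplacian_eigenvalue_ge0 e_sym).
  by rewrite eigenvalue_root_char pE root_prod_XsubC.
have := Cayley_Hamilton (laplacian_mx e); rewrite pE rmorph_prod => <-.
by apply: eq_bigr => d _; rewrite rmorphB /= horner_mx_X horner_mx_C.
Qed.

(** * Harmonicity as a recurrence along the lines *)

Definition cartesian_recurrence (T : finType) (e : rel T) (phi : T * int -> int) :=
  forall u i, phi (u, i + 1) + phi (u, i - 1) =
    2 * phi (u, i) + \sum_(v | e u v) (phi (u, i) - phi (v, i)).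

Lemma harmonic_cartesian_recurrence (T : finType) (e : rel T) phi :
  irreflexive e -> harmonic (cartesian e int_adj) phi ->
  cartesian_recurrence e phi.
Proof.
move=> e_irr hphi u i.
have := hphi (u, i); rewrite degree_cartesian_int //.
set s := [:: (u, i + 1), (u, i - 1) & [seq (v, i) | v <- enum (e u)]].
have us : uniq s.
  have notin j : (u, j) \notin [seq (v, i) | v <- enum (e u)].
    apply/mapP => -[v]; rewrite mem_enum => euv [uv _].
    by move: euv; rewrite -uv unfold_in e_irr.
  rewrite /s /= !inE negb_or !notin andbT /=; apply/andP; split.
    by rewrite xpair_eqE eqxx (inj_eq (addrI i)).
  by rewrite map_inj_uniq ?enum_uniq // => v w [].
have ps : perm_eq (fset_set (neighbors (cartesian e int_adj) (u, i))) s.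
  apply: uniq_perm => // x.
  rewrite in_fset_set; last exact: locally_finite_cartesian_int.
  by rewrite neighbors_cartesian_int; apply/idP/idP; rewrite inE.
rewrite (perm_big _ ps) /s !big_cons big_map big_enum /= => h.
(* Multiplying by the nonzero degree turns the rational identity into one between integers. *)
have {h} : (phi (u, i) * (#|e u| + 2)%N%:R)%:~R =
    (phi (u, i + 1) + (phi (u, i - 1) + \sum_(v | e u v) phi (v, i)))%:~R :> rat.
  rewrite rmorphM /= h natz -pmulrn mulrAC mulVf ?mul1r ?pnatr_eq0 ?addn2 //.
  by rewrite !rmorphD /= rmorph_sum.
move=> /intr_inj h.
rewrite sumrB sumr_const; move: h; rewrite natrD mulrDr mulr_natr.
move: (phi (u, i) *+ _) (\sum_(v | _) _) => D S h.
by apply: (addIr S); rewrite -addrA -h; ring.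
Qed.

(** Carries estimates at the positive end of a line over to the negative end. *)
Lemma cartesian_recurrence_rev (T : finType) (e : rel T) phi :
  cartesian_recurrence e phi ->
  cartesian_recurrence e (fun x => phi (x.1, - x.2)).
Proof.
by move=> rec u i; rewrite /= opprD opprB [1 - i]addrC [LHS]addrC; exact: rec.
Qed.

(** The slices [f i] satisfy the matrix recurrence, and so do their images [f i *m L]. The free
    start [k] lets a single nonzero value, at [i = 0], exclude the identically zero case. *)
Lemma laplacian_eventually_signed (T : finType) (e : rel T) phi (u : T) (k : int) :
  symmetric e -> cartesian_recurrence e phi ->
  eventually_signed (fun i : nat =>
    \sum_(v | e u v) (phi (u, k + i%:Z) - phi (v, k + i%:Z))).
Proof.
move=> e_sym rec.
have [n cardT] : exists n, #|T| = n.+1.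
  by exists #|T|.-1; rewrite prednK //; apply/card_gt0P; exists u.
pose h (i : 'I_n.+1) : T := enum_val (cast_ord (esym cardT) i).
have h_bij : bijective h.
  by apply: bij_comp; [exact: enum_val_bij | exists (cast_ord cardT) => i;
    rewrite ?cast_ordK ?cast_ordKV].
have [h' hK h'K] := h_bij.
pose e' : rel 'I_n.+1 := relpre h e.
have e'_sym : symmetric e' by move=> i j; rewrite /e' /= e_sym.
have [ds ds0 dsL] := laplacian_mx_annihilator e'_sym.
pose L := laplacian_mx e'.
pose f (i : nat) : 'rV[algC]_n.+1 := \row_j (phi (h j, k + i%:Z))%:~R.
have fL i j : (f i *m L) 0 j =
    (\sum_(v | e (h j) v) (phi (h j, k + i%:Z) - phi (v, k + i%:Z)))%:~R.
  rewrite mul_laplacian_mx rmorph_sum (reindex h) /=; last exact: onW_bij.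
  by apply: eq_bigr => l _; rewrite !mxE rmorphB.
have frec i : f i.+2 + f i = 2 *: f i.+1 + f i.+1 *m L.
  apply/rowP => j; rewrite [LHS]mxE [RHS]mxE fL !mxE.
  rewrite -(intrD algC) -[2]/(2%:~R) -(intrM algC) -(intrD algC) -rec.
  by congr (phi (_, _) + phi (_, _))%:~R; lia.
have : eventually_signed (fun i => (f i *m L) 0 (h' u)).
  apply: (@eventually_signed_matrix_recurrence _ L ds (fun i => f i *m L)) => //.
  - move=> i j; rewrite mxE rpredB ?rpredMn ?rpred1 //.
  - by move=> i j; rewrite fL Rreal_int // intr_int.
  - by move=> i; rewrite -mulmxDl frec mulmxDl scalemxAl.
  - by move=> i; rewrite dsL mulmx0.
case=> [[N fN]|[N fN]|f0].
- by apply: Or31; exists N => i /fN; rewrite fL h'K ltr0z.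
- by apply: Or32; exists N => i /fN; rewrite fL h'K ltrz0.
- by apply: Or33 => i; have := f0 i; rewrite fL h'K => /eqP; rewrite intr_eq0 => /eqP.
Qed.

(** * Affine and superlinear lines *)

(** A positive integer second difference is at least 1, so the slopes eventually exceed any
    bound. *)
Lemma convex_superlinear (x : nat -> int) (N : nat) (C : int) :
  (forall i, (N <= i)%N -> 0 < x i.+2 + x i - 2 * x i.+1) ->
  exists R : nat, forall i : nat, (R <= i)%N -> C * i%:Z <= x i.
Proof.
move=> x_cvx.
have slope k : x N.+1 - x N + k%:Z <= x (N + k).+1 - x (N + k)%N.
  elim: k => [|k IHk]; first by rewrite addn0 addr0.
  by have := x_cvx (N + k)%N (leq_addr _ _); rewrite addnS; lia.
(* From [P] on the slope is at least [C + 1]; the surplus 1 per step then absorbs the constant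
   [C * P - x P]. *)
pose P := (N + `|(C + 1 - (x N.+1 - x N))%R|)%N.
have growth k : x P + (C + 1) * k%:Z <= x (P + k)%N.
  elim: k => [|k IHk]; first by rewrite addn0 mulr0 addr0.
  have := slope (`|(C + 1 - (x N.+1 - x N))%R| + k)%N; rewrite addnA -/P addnS => sl.
  have {}sl : C + 1 <= x (P + k).+1 - x (P + k)%N by lia.
  by rewrite -[k.+1%:Z]/(1 + k)%:Z PoszD mulrDr mulr1; lia.
exists (P + `|(C * P%:Z - x P)%R|)%N => i iR.
have Pi : (P <= i)%N by lia.
have := growth (i - P)%N; rewrite subnKC // => gr; apply: le_trans gr.
rewrite -subzn // mulrBr mulrDl mul1r mulrDl mul1r.
by move: iR; move: (C * P%:Z) (C * i%:Z) => CP Ci; lia.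
Qed.

Lemma int_affine (x : int -> int) :
  (forall i, x (i + 1) + x (i - 1) = 2 * x i) ->
  forall i, x i = x 0 + i * (x 1 - x 0).
Proof.
move=> x_aff.
have xS i : x (i + 1) = 2 * x i - x (i - 1) by rewrite -x_aff addrK.
have xP i : x (i - 1) = 2 * x i - x (i + 1) by rewrite -x_aff [_ + x _]addrC addrK.
have x_pos (n : nat) : x n%:Z = x 0 + n%:Z * (x 1 - x 0) /\
    x (n%:Z + 1) = x 0 + (n%:Z + 1) * (x 1 - x 0).
  elim: n => [|n [IH0 IH1]].
    by split; [rewrite mul0r addr0 | rewrite add0r mul1r addrC subrK].
  rewrite -addn1 PoszD; split=> //.
  by rewrite xS addrK IH0 IH1; ring.
have x_neg (n : nat) : x (- n%:Z) = x 0 - n%:Z * (x 1 - x 0) /\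
    x (- n%:Z - 1) = x 0 - (n%:Z + 1) * (x 1 - x 0).
  elim: n => [|n [IH0 IH1]].
    split; first by rewrite oppr0 mul0r subr0.
    by rewrite xP oppr0 !add0r; ring.
  rewrite -addn1 PoszD opprD; split=> //.
  by rewrite xP subrK IH0 IH1; ring.
move=> i; have [n [->|->]] : exists n : nat, i = n%:Z \/ i = - n%:Z.
- by exists `|i|%N; lia.
- exact: (x_pos n).1.
- by rewrite (x_neg n).1 mulNr.
Qed.

Lemma half_line_superlinear (T : finType) (e : rel T) phi (u : T) (k C : int) :
  symmetric e -> cartesian_recurrence e phi ->
  \sum_(v | e u v) (phi (u, k) - phi (v, k)) != 0 ->
  exists R : nat, forall i : nat, (R <= i)%N -> C * i%:Z <= `|phi (u, i%:Z)|.
Proof.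
move=> e_sym rec k_neq0.
have phiE (i : nat) : \sum_(v | e u v) (phi (u, i.+1%:Z) - phi (v, i.+1%:Z)) =
    phi (u, i.+2%:Z) + phi (u, i%:Z) - 2 * phi (u, i.+1%:Z).
  have := rec u i.+1%:Z.
  have [-> ->] : i.+1%:Z + 1 = i.+2 /\ i.+1%:Z - 1 = i by split; lia.
  by move=> ->; rewrite addrC addKr.
(* Signs are known from [k] on, which may be negative, but the line is read from 0; the second
   difference is centred at [i.+1]. *)
have shift N (i : nat) : (`|k| + N <= i)%N ->
    exists2 j : nat, (N <= j)%N & i.+1%:Z = k + j%:Z.
  by move=> iN; exists `|(i.+1%:Z - k)%R|%N; lia.
have [[N yN]|[N yN]|y0] := laplacian_eventually_signed u k e_sym rec.
- have [|R xR] := @convex_superlinear (fun i => phi (u, i%:Z)) (`|k| + N) C.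
    by move=> i /shift[j /yN Nj ij]; rewrite -phiE ij.
  by exists R => i /xR xi; apply: le_trans xi (ler_norm _).
- have [|R xR] := @convex_superlinear (fun i => - phi (u, i%:Z)) (`|k| + N) C.
    move=> i /shift[j /yN Nj ij]; rewrite mulrN -!opprD oppr_gt0.
    by rewrite -phiE ij.
  by exists R => i /xR xi; apply: le_trans xi _; rewrite -normrN ler_norm.
- by move: k_neq0; have := y0 0%N; rewrite addr0 => ->; rewrite eqxx.
Qed.

Lemma line_superlinear (T : finType) (e : rel T) phi (u : T) (k C : int) :
  symmetric e -> cartesian_recurrence e phi ->
  \sum_(v | e u v) (phi (u, k) - phi (v, k)) != 0 ->
  exists R : nat, forall i : int, (R <= `|i|)%N -> C * `|i| <= `|phi (u, i)|.
Proof.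
move=> e_sym rec k_neq0.
have [R1 phi1] := half_line_superlinear C e_sym rec k_neq0.
have [|R2 phi2] := @half_line_superlinear T e _ u (- k) C e_sym
    (cartesian_recurrence_rev rec).
  by rewrite /= opprK.
exists (maxn R1 R2) => i; rewrite geq_max => /andP[/phi1 + /phi2] /=.
by rewrite abszE; case: (ger0P i); rewrite ?opprK.
Qed.

(** * Maximum principle and counting *)

(** At a maximum of [f] over the non-isolated vertices, the differences to the neighbors are
    nonnegative with sum zero, so all vanish. *)
Lemma laplacian_eq0_edge (T : finType) (e : rel T) (f : T -> int) :
  symmetric e -> (exists u v, e u v) ->
  (forall u, \sum_(v | e u v) (f u - f v) = 0) ->
  exists u v, e u v /\ f u = f v.
Proof.
move=> e_sym [u0 [v0 e0]] f0.
have u0P : [exists v, e u0 v] by apply/existsP; exists v0.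
case: (@arg_maxP _ _ _ u0 (fun u => [exists v, e u v]) f u0P) => u /existsP[v euv] umax.
exists u, v; split=> //; apply/eqP; rewrite -subr_eq0; apply/eqP.
apply: (psumr_eq0P _ (f0 u)) => // w euw; rewrite subr_ge0.
by apply: umax; apply/existsP; exists u; rewrite e_sym.
Qed.

Theorem theorem3 (T : finType) (e : rel T) (e_sym : symmetric e)
    (e_irr : irreflexive e) (e_edge : exists u v : T, e u v) :
  ~ exists phi : T * int -> int, harmonic_labeling (cartesian e int_adj) phi.
Proof.
case=> phi [/(harmonic_cartesian_recurrence e_irr) rec [psi phiK psiK]].
have phi_inj := can_inj phiK.
pose y u i := \sum_(v | e u v) (phi (u, i) - phi (v, i)).
pose A u := `[< forall i, y u i = 0 >].
(* Otherwise slice 0 has zero Laplacian, and two adjacent vertices in it share a label. *)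
have [u0 u0A] : exists u, ~~ A u.
  apply: contrapT => /forallNP allA.
  have [|u [v [euv uv]]] := @laplacian_eq0_edge T e (fun u => phi (u, 0)) e_sym e_edge.
    by move=> u; have /negP := allA u; rewrite negbK => /asboolP; exact.
  by case: (phi_inj _ _ uv) euv => ->; rewrite e_irr.
pose b u := phi (u, 1) - phi (u, 0).
have affine u i : A u -> phi (u, i) = phi (u, 0) + i * b u.
  move=> /asboolP yu; apply: (int_affine (x := fun i => phi (u, i))) => j.
  by rewrite rec -/(y u j) yu addr0.
have b_neq0 u : b u != 0 by rewrite subr_eq0; apply/eqP => /phi_inj.
pose M := \prod_(u | A u) b u.
have M_neq0 : M != 0 by apply/prodf_neq0.
pose r := phi (u0, 0).
(* The slope of an affine line divides [M], so a line meeting [r + M Z] would also take the value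
   [r], which belongs to the line of [u0]. *)
have residue (k : int) : ~~ A (psi (r + M * k)).1.
  apply/negP => uA; have := psiK (r + M * k); set p := psi _ in uA *.
  rewrite [p]surjective_pairing affine // => pE.
  have [q Mq] : exists q, M = b p.1 * q by rewrite /M (bigD1 p.1) //; eexists.
  suff : phi (p.1, p.2 - k * q) = phi (u0, 0).
    by move=> /phi_inj[pu0 _]; move: u0A; rewrite -pu0 uA.
  rewrite affine // -/r; apply: (addIr (M * k)); rewrite -pE Mq; ring.
(* Chosen, before the radii [R], so that [|r| + |M| * K < C * (Rm + 1)] for the [K] below, whatever
   [Rm] is. *)
pose C := `|r| + `|M| * (2 * #|T|%:Z) + 1.
have /choice[R phiR] u : exists R : nat, ~~ A u ->
    forall i : int, (R <= `|i|)%N -> C * `|i| <= `|phi (u, i)|.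
  have [uA|/asboolPn/existsNP[k /eqP yk]] := boolP (A u); first by exists 0%N.
  by have [R phiR] := line_superlinear C e_sym rec yk; exists R.
pose Rm := \max_u R u.
(* The number of vertices of the box of height coordinates between [- Rm] and [Rm]. *)
pose K := (#|T| * Rm.*2.+1)%N.
(* A vertex of a non-affine line outside the box has a label of size at least [C * (Rm + 1)], too
   large for [r + M * k] with [k <= K]. *)
have bounded (k : 'I_K.+1) : (`|(psi (r + M * k%:Z)%R).2| <= Rm)%N.
  rewrite leqNgt; apply/negP => Rmi.
  have := phiR _ (residue k%:Z) _ (leq_trans (leq_bigmax _) (ltnW Rmi)).
  rewrite -surjective_pairing psiK; apply/negP; rewrite -ltNge.
  apply: (@le_lt_trans _ _ (`|r| + `|M| * K%:Z)).
    apply: le_trans (ler_normD _ _) _; rewrite lerD2l normrM ler_wpM2l //.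
    by have := ltn_ord k; lia.
  apply: (@lt_le_trans _ _ (C * (Rm%:Z + 1))).
    have -> : K%:Z = 2 * #|T|%:Z * Rm%:Z + #|T|%:Z by rewrite /K; lia.
    have := normr_ge0 r; have := normr_ge0 M; rewrite /C.
    by move: `|r| `|M| => a c; nia.
  by apply: ler_wpM2l; [rewrite !addr_ge0 ?mulr_ge0 | lia].
(* Pigeonhole: [K + 1] labels lie in a box of [K] vertices. Adding [Rm] makes the height a natural
   number at most [2 * Rm], so [inord] never takes its default value. *)
pose g (k : 'I_K.+1) : T * 'I_Rm.*2.+1 :=
  ((psi (r + M * k%:Z)).1, inord `|((psi (r + M * k%:Z)).2 + Rm%:Z)%R|).
have g_inj : injective g.
  have inordE (i : int) : (`|i| <= Rm)%N ->
      (inord `|(i + Rm%:Z)%R| : 'I_Rm.*2.+1)%:Z = i + Rm%:Z.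
    by move=> iR; rewrite inordK; lia.
  move=> k l; case=> kl1 /(congr1 (fun j : 'I_Rm.*2.+1 => j%:Z)).
  rewrite !inordE ?bounded // => /addIr kl2.
  have : psi (r + M * k%:Z) = psi (r + M * l%:Z).
    by rewrite [LHS]surjective_pairing [RHS]surjective_pairing kl1 kl2.
  move=> /(can_inj psiK)/addrI/(mulfI M_neq0) kl; apply: val_inj; by case: kl.
by have := leq_card g g_inj; rewrite card_prod !card_ord ltnn.
Qed.
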